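(* For all integers $n,h,b\ge0$, $G_n(h,b)=H_n(h,b)$, where $G_n(h,b)=|\mathcal{B}^{(h,b)}_{n+1}(231)|$ and $H_n(h,b)=|\mathcal{H}(n;h,b)|$. In particular, for every $n\ge1$, $|\mathcal{B}_n(231)|=C(\lfloor n/2\rfloor)\,C(\lfloor (n+1)/2\rfloor)$, where $C(m)=\frac{1}{m+1}\binom{2m}{m}$.
   Context: For integers $h,b\ge0$, a permutation $\pi\in\mathfrak{S}_{n+1}$ is an $(h,b)$-ballot permutation if the lattice path starting at $(0,h)$ whose $i$th step ($i\in[n]$) is $(1,1)$ if $\pi_i<\pi_{i+1}$ and $(1,-1)$ if $\pi_i>\pi_{i+1}$ ends at $(n,b)$ and never goes below the $x$-axis. Ballot permutations $\mathcal{B}_m$ are the $(0,b)$-ballot permutations in $\mathfrak{S}_m$ for some $b\ge0$ (every prefix has at most as many descents as ascents). $\mathcal{B}^{(h,b)}_{n+1}(231)$ (resp. $\mathcal{B}_m(231)$) denotes those with no subsequence order-isomorphic to $231$. A Gouyou-Beauchamps (GB) walk is a lattice path confined to $\{(x,y)\in\mathbb{N}^2: y\le x\}$ with steps from $\{(0,1),(0,-1),(-1,0),(1,0)\}$; $\mathcal{H}(n;h,b)$ is the set of $n$-step GB walks from $(h,0)$ to $(b,0)$. *)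

(* Defs.v *)
From mathcomp Require Import all_boot all_order all_algebra all_fingroup.
From mathcomp Require Import ssrint.
Set Implicit Arguments. Unset Strict Implicit. Unset Printing Implicit Defensive.
Import GRing.Theory Num.Theory.

Definition pword (m : nat) (s : 'S_m) : seq nat := [seq val (s i) | i <- enum 'I_m].

Definition pheight (m : nat) (s : 'S_m) (h : nat) (k : nat) : int :=
  ((Posz h) + \sum_(i < k) (if (nth 0 (pword s) i < nth 0 (pword s) i.+1)%N
                        then 1 else -1))%R.

Definition hb_ballot (m : nat) (h b : nat) (s : 'S_m) : bool :=
  [forall k : 'I_m, (0 <= pheight s h k)%R] && (pheight s h m.-1 == (Posz b)).

(* Ballot permutation: a (0,b)-ballot permutation for some b >= 0
   (the final height of a path with m-1 steps is at most m-1 < m.+1). *)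
Definition ballot (m : nat) (s : 'S_m) : bool :=
  [exists b : 'I_m.+1, hb_ballot 0 b s].

Definition avoids231 (m : nat) (s : 'S_m) : bool :=
  [forall i : 'I_m, forall j : 'I_m, forall k : 'I_m,
     ~~ [&& i < j, j < k & (s k < s i < s j)]].

(* Gouyou-Beauchamps walks: steps coded by 'I_4. *)
Definition gb_step (d : 'I_4) : int * int :=
  match val d with
  | 0 => (0, 1)%Z
  | 1 => (0, -1)%Z
  | 2 => (-1, 0)%Z
  | _ => (1, 0)%Z
  end.

Definition gb_add (p : int * int) (d : 'I_4) : int * int :=
  ((p.1 + (gb_step d).1)%R, (p.2 + (gb_step d).2)%R).

Definition gb_points (h : nat) (w : seq 'I_4) : seq (int * int) :=
  ((Posz h), 0%Z) :: scanl gb_add ((Posz h), 0%Z) w.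

Definition in_GB (p : int * int) : bool :=
  [&& (0 <= p.1)%R, (0 <= p.2)%R & (p.2 <= p.1)%R].

Definition gb_walk (n h b : nat) (w : n.-tuple 'I_4) : bool :=
  all in_GB (gb_points h w) && (last ((Posz h), 0%Z) (gb_points h w) == ((Posz b), 0%Z)).

Definition catalan (m : nat) : nat := 'C(m.*2, m) %/ m.+1.

(* Main.v *)
(** Deleting the first letter [j] of a 231-avoiding permutation leaves a
231-avoiding permutation [s] for which [j] is a cut: the values below [j] all
precede the others. The step deleted is an ascent iff [j = 0]. If [s] has
[t + 2] cuts (including the two trivial ones), the new permutation has [t + 3]
cuts when [j = 0], and each of [2, ..., t + 2] exactly once as [j] runs over the
other cuts. By Pascal's rule and hockey-stick summation, the sums of ['C(t, y)]
over the permutations of height [h] obey the same recursion as the numbers of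
Gouyou-Beauchamps walks from [(h + y, y)], where [y] is the gap between two
noncrossing simple walks, the lower one being the ballot path; take [y = 0].

For the product formula, the reflection principle expresses the number of walks
ending at [(b, 0)] as a 2x2 determinant of simple walk numbers, which telescopes
when summed over [b]. *)

Require Import Defs.
From mathcomp Require Import all_boot all_order all_algebra all_fingroup.
From mathcomp Require Import zify ring.
Set Implicit Arguments. Unset Strict Implicit. Unset Printing Implicit Defensive.
Import GRing.Theory Num.Theory.

(** * Simple walks on the integers and Catalan numbers *)

Fixpoint simple_walks (n : nat) (d : int) : int :=
  if n is n'.+1 then (simple_walks n' (d - 1) + simple_walks n' (d + 1))%R
  else Posz (d == 0%R).

Lemma simple_walks_opp n d : simple_walks n (- d)%R = simple_walks n d.
Proof.
elim: n d => [|n IH] d /=; first by rewrite oppr_eq0.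
by rewrite addrC -!(IH (- d + _)%R) !opprD !opprK.
Qed.

Lemma simple_walks_far n (d : int) : (n%:Z < d)%R -> simple_walks n d = 0%R.
Proof.
elim: n d => [|n IH] d ltnd /=; first by case: eqP => //; lia.
by rewrite !IH; lia.
Qed.

Lemma simple_walks2 n d :
  simple_walks n.+2 d =
  (simple_walks n (d - 2) + simple_walks n d *+ 2 + simple_walks n (d + 2))%R.
Proof.
rewrite /=; have -> : (d - 1 - 1 = d - 2)%R by lia.
have -> : (d - 1 + 1 = d)%R by lia.
have -> : (d + 1 - 1 = d)%R by lia.
have -> : (d + 1 + 1 = d + 2)%R by lia.
ring.
Qed.

Lemma simple_walks_even_odd m (d : int) : simple_walks m.*2 (d *+ 2 + 1)%R = 0%R.
Proof.
elim: m d => [|m IH] d; first by rewrite /=; case: eqP => //; lia.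
rewrite doubleS simple_walks2.
have -> : (d *+ 2 + 1 - 2 = (d - 1) *+ 2 + 1)%R by lia.
have -> : (d *+ 2 + 1 + 2 = (d + 1) *+ 2 + 1)%R by lia.
by rewrite !IH.
Qed.

Lemma simple_walks_odd_even m (d : int) : simple_walks m.*2.+1 (d *+ 2)%R = 0%R.
Proof.
rewrite /= simple_walks_even_odd.
have -> : (d *+ 2 - 1 = (d - 1) *+ 2 + 1)%R by lia.
by rewrite simple_walks_even_odd.
Qed.

(** Here [k] is the number of down steps, and the recursion becomes Pascal's rule. *)
Lemma simple_walks_bin n k : simple_walks n (n%:Z - k%:Z *+ 2)%R = Posz 'C(n, k).
Proof.
elim: n k => [|n IH] [|k] /=.
- by [].
- by rewrite bin0n; lia.
- have -> : (n.+1%:Z - 0%:Z *+ 2 - 1 = n%:Z - 0%:Z *+ 2)%R by lia.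
  by rewrite IH simple_walks_far ?bin0 //; lia.
- have -> : (n.+1%:Z - k.+1%:Z *+ 2 - 1 = n%:Z - k.+1%:Z *+ 2)%R by lia.
  have -> : (n.+1%:Z - k.+1%:Z *+ 2 + 1 = n%:Z - k%:Z *+ 2)%R by lia.
  by rewrite !IH binS PoszD.
Qed.

Lemma catalan_bin m : Posz (catalan m) = ('C(m.*2, m)%:Z - 'C(m.*2, m.+1)%:Z)%R.
Proof.
have := mul_bin_left m.*2 m; rewrite -addnn addnK addnn => E.
(* By [E] the subtrahend is at most 'C(m.*2, m), so the truncated difference is exact. *)
suff {1}-> : catalan m = ('C(m.*2, m) - 'C(m.*2, m.+1))%N by nia.
rewrite /catalan -[RHS](mulKn _ (ltn0Sn m)); congr (_ %/ _).
by rewrite mulnBr E mulSn addnK.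
Qed.

Lemma catalan_simple_walks m :
  Posz (catalan m) = (simple_walks m.*2 0 - simple_walks m.*2 2)%R.
Proof.
rewrite catalan_bin -!simple_walks_bin.
rewrite -[simple_walks _ 2]simple_walks_opp.
by congr (simple_walks _ _ - simple_walks _ _)%R; lia.
Qed.

(** The two-step recursion brings C(m + 1) down to walks of length 2m, where it can be compared with
    C(m). *)
Lemma catalanS_simple_walks m :
  Posz (catalan m.+1) = (simple_walks m.*2 0 - simple_walks m.*2 4)%R.
Proof.
rewrite catalan_simple_walks doubleS !simple_walks2.
rewrite sub0r simple_walks_opp subrr add0r.
have -> : (2 + 2 = 4 :> int)%R by [].
ring.
Qed.

(** * Reflection principle and noncrossing pairs of walks *)

(* Reflection principle: walks from [a] to [b] that stay nonnegative. *)
Definition half_walks n (a b : int) : int :=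
  (simple_walks n (b - a) - simple_walks n (a + b + 2))%R.

Lemma half_walksS n a b :
  half_walks n.+1 a b = (half_walks n (a + 1) b + half_walks n (a - 1) b)%R.
Proof.
rewrite /half_walks /=.
have -> : (b - a - 1 = b - (a + 1))%R by lia.
have -> : (b - a + 1 = b - (a - 1))%R by lia.
have -> : (a + b + 2 - 1 = a - 1 + b + 2)%R by lia.
have -> : (a + b + 2 + 1 = a + 1 + b + 2)%R by lia.
ring.
Qed.

Lemma half_walksN1 n b : half_walks n (-1) b = 0%R.
Proof.
rewrite /half_walks; have -> : (b - -1 = b + 1)%R by lia.
have -> : (-1 + b + 2 = b + 1)%R by lia.
by rewrite subrr.
Qed.

(* Gessel-Viennot determinant for two nonnegative paths, the upper one starting
   at [u] and the lower one at [v], that never cross and both end at [b]; the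
   upper path is raised by 2 so that noncrossing becomes nonintersecting. *)
Definition walk_pairs n (b u v : int) : int :=
  (half_walks n (u + 2) (b + 2) * half_walks n v b
   - half_walks n (u + 2) b * half_walks n v (b + 2))%R.

Lemma walk_pairsS n b u v :
  walk_pairs n.+1 b u v =
  (walk_pairs n b (u + 1) (v + 1) + walk_pairs n b (u - 1) (v + 1)
   + (walk_pairs n b (u - 1) (v - 1) + walk_pairs n b (u + 1) (v - 1)))%R.
Proof.
rewrite /walk_pairs !half_walksS.
have -> : (u + 1 + 2 = u + 2 + 1)%R by lia.
have -> : (u - 1 + 2 = u + 2 - 1)%R by lia.
ring.
Qed.

Lemma walk_pairsN1 n b u : walk_pairs n b u (-1) = 0%R.
Proof. by rewrite /walk_pairs !half_walksN1 !mulr0 subrr. Qed.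

(** Once raised by 2, the upper path starts where the lower one does, so the determinant has two
    equal rows. *)
Lemma walk_pairs_cross n b u : walk_pairs n b u (u + 2) = 0%R.
Proof. by rewrite /walk_pairs mulrC subrr. Qed.

(** * Gouyou-Beauchamps walks as noncrossing pairs *)

(* [gb_walks b n h y] counts the [n]-step Gouyou-Beauchamps walks from
   [(h + y, y)] to [(b, 0)]. *)
Fixpoint gb_walks (b n h y : nat) : nat :=
  if n is n'.+1 then
    gb_walks b n' h.+1 y + (if y is y'.+1 then gb_walks b n' h.+1 y' else 0)
    + (if h is h'.+1 then gb_walks b n' h' y + gb_walks b n' h' y.+1 else 0)
  else (h == b) && (y == 0).

(** In the coordinates u = x + y, v = x - y, each step moves both u and v by 1 up or down, and the
    wedge becomes 0 <= v <= u. Steps leaving the wedge, absent from [gb_walks], lead to zeros of the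
    determinant. *)
Lemma gb_walks_pairs b n h y :
  Posz (gb_walks b n h y) = walk_pairs n b (h + y.*2)%N h.
Proof.
elim: n h y => [|n IH] h y.
  rewrite /= /walk_pairs /half_walks /=.
  set u := (h + y.*2)%N.
  have -> : (b%:Z + 2 - (u%:Z + 2) == 0)%R = (u == b) by lia.
  have -> : (u%:Z + 2 + (b%:Z + 2) + 2 == 0)%R = false by lia.
  have -> : (b%:Z - h%:Z == 0)%R = (h == b) by lia.
  have -> : (h%:Z + b%:Z + 2 == 0)%R = false by lia.
  have -> : (b%:Z - (u%:Z + 2) == 0)%R = (b == u + 2)%N by lia.
  have -> : (u%:Z + 2 + b%:Z + 2 == 0)%R = false by lia.
  have -> : (b%:Z + 2 - h%:Z == 0)%R = (h == b + 2)%N by lia.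
  have -> : (h%:Z + (b%:Z + 2) + 2 == 0)%R = false by lia.
  rewrite !subr0 /u.
  by case: (h =P b) => ?; case: (y =P 0) => ?; case: (_ =P b) => ?;
    case: (b =P _) => ?; case: (h =P _) => ? //=; lia.
rewrite walk_pairsS /= !PoszD; congr (_ + _ + _)%R.
- by rewrite IH; congr walk_pairs; lia.
- case: y => [|y]; last by rewrite IH; congr walk_pairs; lia.
  (* At y = 0 both paths are at h; the upper going down and the lower going up gives the crossed
     pair (h - 1, h + 1). *)
  apply: etrans (esym (walk_pairs_cross n b (h%:Z - 1))) _.
  by congr walk_pairs; lia.
- case: h => [|h]; last first.
    by rewrite PoszD !IH; congr (walk_pairs _ _ _ _ + walk_pairs _ _ _ _)%R; lia.
  by rewrite sub0r !walk_pairsN1.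
Qed.

(** * Summation over the endpoint *)

(* Closed form of [walk_pairs n b 0 0 + walk_pairs n (b + 2) 0 0 + ...]. *)
Definition tail_sum n (b : int) : int :=
  let w k := simple_walks n (b + k)%R in
  (w 0 * w 0 + w 2 * w 2 - w 0 * w 2 + w (- 2) * w 4 - w (- 2) * w 2
   - w 0 * w 4)%R.

Lemma walk_pairs_telescope n b :
  walk_pairs n b 0 0 = (tail_sum n b - tail_sum n (b + 2))%R.
Proof.
rewrite /walk_pairs /half_walks /tail_sum /=.
have -> : (b + 2 - (0 + 2) = b + 0)%R by lia.
have -> : (0 + 2 + (b + 2) + 2 = b + 6)%R by lia.
have -> : (b - 0 = b + 0)%R by lia.
have -> : (0 + b + 2 = b + 2)%R by lia.
have -> : (b - (0 + 2) = b - 2)%R by lia.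
have -> : (0 + 2 + b + 2 = b + 4)%R by lia.
have -> : (b + 2 - 0 = b + 2)%R by lia.
have -> : (0 + (b + 2) + 2 = b + 4)%R by lia.
have -> : (b + 2 + 2 = b + 4)%R by lia.
have -> : (b + 2 + 4 = b + 6)%R by lia.
ring.
Qed.

(** Every term has a factor [w k] with k >= 0; [w (- 2)] never occurs alone. *)
Lemma tail_sum_far n (b : nat) : n < b -> tail_sum n b = 0%R.
Proof.
move=> lt_nb; rewrite /tail_sum.
rewrite !(@simple_walks_far n (b%:Z + 0)%R, @simple_walks_far n (b%:Z + 2)%R,
  @simple_walks_far n (b%:Z + 4)%R); [ring|lia..].
Qed.

Lemma sum_walk_pairs n m : n < m ->
  (\sum_(b < m) walk_pairs n b 0 0 = tail_sum n 0 + tail_sum n 1)%R.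
Proof.
(* The telescoping advances by 2, so even and odd [b] leave one initial and one final term each. *)
move=> lt_nm; transitivity (tail_sum n 0 + tail_sum n 1
    - (tail_sum n m + tail_sum n m.+1))%R; last first.
  by rewrite (tail_sum_far lt_nm) (tail_sum_far (leqW lt_nm)) !addr0.
elim: m {lt_nm} => [|m IH]; first by rewrite big_ord0 subrr.
rewrite big_ord_recr /= IH walk_pairs_telescope.
have -> : (m%:Z + 2 = m.+2)%R by lia.
ring.
Qed.

Lemma sum_gb_walks n k : n < k ->
  \sum_(b < k) gb_walks b n 0 0 = catalan n.+1./2 * catalan n.+2./2.
Proof.
move=> lt_nk; apply/eqP; rewrite -eqz_nat; apply/eqP.
rewrite (big_morph Posz PoszD (erefl _)).
under eq_bigr do rewrite gb_walks_pairs.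
rewrite sum_walk_pairs // PoszM.
set i := n.+1./2; set j := n.+2./2.
rewrite /tail_sum /=.
have N2 : simple_walks n (- 2)%R = simple_walks n 2 by rewrite simple_walks_opp.
have N1 : simple_walks n (- 1)%R = simple_walks n 1 by rewrite simple_walks_opp.
rewrite !add0r addr0.
have -> : (1 - 2 = - 1 :> int)%R by [].
rewrite N1 N2 -[(1 + 2)%R]/(3 : int) -[(1 + 4)%R]/(5 : int).
(* By parity only one of the two tails survives. It factors as (W1 - W3)^2 for odd n and as (W0 -
   W2)(W0 - W4) for even n, where Wi is [simple_walks n i]. *)
have : n = n./2.*2.+1 \/ n = n./2.*2 by lia.
set m := n./2 => -[] En; rewrite En.
- have W0 : simple_walks m.*2.+1 0 = 0%R := simple_walks_odd_even m 0.
  have W2 : simple_walks m.*2.+1 2 = 0%R := simple_walks_odd_even m 1.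
  have W4 : simple_walks m.*2.+1 4 = 0%R := simple_walks_odd_even m 2.
  have W1 : simple_walks m.*2.+1 1 = (simple_walks m.*2 0 + simple_walks m.*2 2)%R by [].
  have W3 : simple_walks m.*2.+1 3 = (simple_walks m.*2 2 + simple_walks m.*2 4)%R by [].
  have -> : i = m.+1 by lia.
  have -> : j = m.+1 by lia.
  rewrite catalanS_simple_walks W0 W2 W4 W1 W3.
  ring.
- have W1 : simple_walks m.*2 1 = 0%R := simple_walks_even_odd m 0.
  have W3 : simple_walks m.*2 3 = 0%R := simple_walks_even_odd m 1.
  have W5 : simple_walks m.*2 5 = 0%R := simple_walks_even_odd m 2.
  have -> : i = m by lia.
  have -> : j = m.+1 by lia.
  rewrite catalan_simple_walks catalanS_simple_walks W1 W3 W5.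
  ring.
Qed.

(** * Gouyou-Beauchamps walks as step sequences *)

Lemma big_tuple_cons (T : finType) n (F : n.+1.-tuple T -> nat) :
  \sum_w F w = \sum_d \sum_(w : n.-tuple T) F [tuple of d :: w].
Proof.
rewrite pair_big /=.
rewrite (reindex (fun p : T * n.-tuple T => [tuple of p.1 :: p.2])) //=.
exists (fun w => (thead w, [tuple of behead w])) => [[d w] _|w _] /=.
  by congr pair; apply: val_inj.
by rewrite [RHS]tuple_eta.
Qed.

(** The start is any integer point, even outside the wedge, so that induction can remove the first
    step. *)
Definition gb_from (b : nat) (p : int * int) (w : seq 'I_4) : bool :=
  all in_GB (p :: scanl gb_add p w) && (last p (scanl gb_add p w) == (Posz b, 0%R)).

Lemma sum_gb_from b n (h y : nat) :
  \sum_(w : n.-tuple 'I_4) gb_from b ((h + y)%N%:Z, y%:Z)%R w = gb_walks b n h y.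
Proof.
elim: n h y => [|n IH] h y.
  rewrite (big_pred1 [tuple]) => [|w]; last by apply/esym/eqP/tuple0.
  rewrite /gb_from /= /in_GB xpair_eqE /=; lia.
have out (p : int * int) : ~~ in_GB p ->
    \sum_(w : n.-tuple 'I_4) gb_from b p w = 0.
  by move=> pF; rewrite big1 // => w _; rewrite /gb_from /= (negPf pF).
have step d : \sum_(w : n.-tuple 'I_4)
      gb_from b ((h + y)%N%:Z, y%:Z)%R [tuple of d :: w] =
    \sum_(w : n.-tuple 'I_4) gb_from b (gb_add ((h + y)%N%:Z, y%:Z)%R d) w.
  apply: eq_bigr => w _; rewrite /gb_from /=.
  suff -> : in_GB ((h + y)%N%:Z, y%:Z)%R by [].
  by rewrite /in_GB /=; lia.
rewrite big_tuple_cons; under eq_bigr do rewrite step.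
rewrite !big_ord_recl big_ord0 /gb_add /gb_step /= addn0 !addr0.
set N := \sum_(w : n.-tuple _) gb_from b (_, (_ + 1)%R) _.
set S := \sum_(w : n.-tuple _) gb_from b (_, (_ + -1)%R) _.
set W := \sum_(w : n.-tuple _) gb_from b ((_ + -1)%R, _) _.
set E := \sum_(w : n.-tuple _) gb_from b ((_ + 1)%R, _) _.
have IHE p h' y' : p = (Posz (h' + y'), Posz y') ->
    \sum_(w : n.-tuple 'I_4) gb_from b p w = gb_walks b n h' y'.
  by move=> ->; rewrite IH.
have -> : E = gb_walks b n h.+1 y by apply: IHE; congr pair; lia.
have -> : S = if y is y'.+1 then gb_walks b n h.+1 y' else 0.
  rewrite /S; case: (y) => [|y']; first by rewrite out // /in_GB /=; lia.
  by apply: IHE; congr pair; lia.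
have -> : W = if h is h'.+1 then gb_walks b n h' y else 0.
  rewrite /W; case: (h) => [|h']; first by rewrite out // /in_GB /=; lia.
  by apply: IHE; congr pair; lia.
have -> : N = if h is h'.+1 then gb_walks b n h' y.+1 else 0.
  rewrite /N; case: (h) => [|h']; first by rewrite out // /in_GB /=; lia.
  by apply: IHE; congr pair; lia.
by case: (h) => [|h']; lia.
Qed.

Lemma card_gb_walk n h b :
  #|[set w : n.-tuple 'I_4 | gb_walk h b w]| = gb_walks b n h 0.
Proof.
rewrite -sum1dep_card big_mkcond -sum_gb_from addn0.
apply: eq_bigr => w _; rewrite -[gb_from b _ w]/(gb_walk h b w).
by case: gb_walk.
Qed.

(** * Deleting the first letter, and cuts *)

Lemma big_lift_perm n (F : 'S_n.+1 -> nat) :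
  \sum_s F s = \sum_(s : 'S_n) \sum_(j : 'I_n.+1) F (lift_perm ord0 j s).
Proof.
rewrite exchange_big pair_big /=.
apply: (reindex (fun p : 'I_n.+1 * 'S_n => lift_perm ord0 p.1 p.2)).
apply: onW_bij; apply: inj_card_bij => [[j s] [j' s'] /= E|].
  have Ej : j = j' by rewrite -(lift_perm_id ord0 j s) E lift_perm_id.
  subst j'; congr pair; apply/permP => i; apply: (@lift_inj _ j).
  by rewrite -!(lift_perm_lift ord0) E.
by rewrite card_prod card_ord !card_Sn factS.
Qed.

Definition cut m (s : 'S_m) (c : nat) : bool :=
  [forall i : 'I_m, forall k : 'I_m, (i < k) ==> ~~ (s k < c <= s i)].

Lemma cutP m (s : 'S_m) c :
  reflect (forall i k : 'I_m, i < k -> ~~ (s k < c <= s i)) (cut s c).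
Proof.
apply: (iffP forallP) => cP i; first by move=> k; apply/implyP/(forallP (cP i)).
by apply/forallP => k; apply/implyP/cP.
Qed.

Definition cuts m (s : 'S_m) : seq nat := [seq c <- iota 0 m.+1 | cut s c].

Lemma cut0 m (s : 'S_m) : cut s 0.
Proof. by apply/cutP => i k _; rewrite ltn0. Qed.

Lemma cut_max m (s : 'S_m) : cut s m.
Proof. by apply/cutP => i k _; have := ltn_ord (s i); lia. Qed.

Lemma avoids231P m (s : 'S_m) :
  reflect (forall i j k : 'I_m, i < j -> j < k -> ~~ (s k < s i < s j))
    (avoids231 s).
Proof.
apply: (iffP forallP) => sP i.
  by move=> j k ij jk; move/forallP/(_ j)/forallP/(_ k): (sP i); rewrite ij jk.
apply/forallP => j; apply/forallP => k; apply/negP => /and3P[ij jk].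
exact/negP/sP.
Qed.

(** The first letter can only play the 2 of a pattern 231; the 3 and the 1 are then a pair violating
    the cut at [j]. *)
Lemma avoids231_lift n (j : 'I_n.+1) (s : 'S_n) :
  avoids231 (lift_perm ord0 j s) = avoids231 s && cut s j.
Proof.
apply/avoids231P/andP => [tP|[/avoids231P sP /cutP cP] i1 i2 i3].
  split.
    apply/avoids231P => i1 i2 i3 lt12 lt23.
    have := tP (lift ord0 i1) (lift ord0 i2) (lift ord0 i3) lt12 lt23.
    by rewrite !lift_perm_lift /= /bump; lia.
  apply/cutP => i k lt_ik; have := tP ord0 (lift ord0 i) (lift ord0 k) isT lt_ik.
  by rewrite !lift_perm_lift lift_perm_id /= /bump; lia.
case: (unliftP ord0 i2) => [i2' ->|-> //].
case: (unliftP ord0 i3) => [i3' ->|-> //].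
case: (unliftP ord0 i1) => [i1' ->|->] lt12 lt23; rewrite ?lift_perm_id !lift_perm_lift.
  by have := sP i1' i2' i3' lt12 lt23; rewrite /= /bump; lia.
by have := cP i2' i3' lt23; rewrite /= /bump; lia.
Qed.

Lemma cut_lift n (j : 'I_n.+1) (s : 'S_n) c :
  cut (lift_perm ord0 j s) c.+1 = (j <= c) && cut s c.
Proof.
apply/cutP/andP => [tP|[le_jc /cutP cP] i k].
  have le_jc : j <= c.
    rewrite leqNgt; apply/negP => lt_cj.
    have n_gt0 : 0 < n by have := ltn_ord j; lia.
    (* If c < j, the letter 0 of [s] stays 0 and follows the first letter [j], which violates the
       cut at c + 1. *)
    have := tP ord0 (lift ord0 (s^-1%g (Ordinal n_gt0))) isT.
    by rewrite lift_perm_id lift_perm_lift permKV /= /bump; lia.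
  split=> //; apply/cutP => i k lt_ik.
  have := tP (lift ord0 i) (lift ord0 k) lt_ik.
  by rewrite !lift_perm_lift /= /bump; lia.
case: (unliftP ord0 k) => [k' ->|-> //].
case: (unliftP ord0 i) => [i' ->|->] lt_ik; rewrite ?lift_perm_id !lift_perm_lift.
  by have := cP i' k' lt_ik; rewrite /= /bump; lia.
by rewrite /=; lia.
Qed.

Lemma cuts_lift n (j : 'I_n.+1) (s : 'S_n) :
  cuts (lift_perm ord0 j s) = 0 :: [seq c.+1 | c <- cuts s & j <= c].
Proof.
rewrite {1}/cuts -[iota 0 n.+2]/([:: 0] ++ iota (1 + 0) n.+1) filter_cat.
rewrite iotaDl filter_map [filter _ [:: 0]]/= cut0 cat1s -filter_predI.
congr cons.
by congr map; apply: eq_filter => c /=; rewrite add1n cut_lift.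
Qed.

Lemma sum_cuts m (s : 'S_m) (F : nat -> nat) :
  \sum_(j < m.+1 | cut s j) F j = \sum_(c <- cuts s) F c.
Proof. by rewrite big_filter -(big_mkord (cut s) F) /index_iota subn0. Qed.

(** The trivial cuts 0 and m + 1 are distinct, so subtracting 2 from the number of cuts never
    truncates. *)
Lemma cutsE m (s : 'S_m.+1) :
  exists l, cuts s = 0 :: rcons l m.+1 /\ sorted ltn (0 :: rcons l m.+1).
Proof.
exists [seq c <- iota 1 m | cut s c].
suff E : cuts s = 0 :: rcons [seq c <- iota 1 m | cut s c] m.+1.
  by split; rewrite // -E sorted_filter ?iota_ltn_sorted //; apply: ltn_trans.
rewrite /cuts -[m.+2]addn1 iotaD filter_cat /= cut0 add0n cut_max.
by rewrite cats1.
Qed.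

(* Hockey-stick summation, reading [l] from its largest element down. *)
Lemma sum_bin_sorted (l : seq nat) y : sorted ltn l ->
  \sum_(c <- l) 'C((size [seq d <- l | c <= d]).-1, y) = 'C(size l, y.+1).
Proof.
elim: l => [|a l IH] al; first by rewrite big_nil bin0n.
have /allP gt_a : all (ltn a) l by apply: order_path_min al; apply: ltn_trans.
rewrite big_cons /= leqnn binS addnC -IH ?(path_sorted al) //; congr (_ + _).
  by apply: eq_big_seq => c /gt_a /=; rewrite ltnNge => /negPf ->.
congr 'C(_, _); rewrite /=; congr size; apply/all_filterP/allP => d /gt_a.
exact: ltnW.
Qed.

(** * Heights after deleting the first letter *)

Lemma pword_lift n (j : 'I_n.+1) (s : 'S_n) :
  pword (lift_perm ord0 j s) = val j :: map (bump j) (pword s).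
Proof.
rewrite /pword enum_ordSl /= lift_perm_id -!map_comp.
by congr cons; apply: eq_map => i /=; rewrite lift_perm_lift.
Qed.

Lemma size_pword n (s : 'S_n) : size (pword s) = n.
Proof. by rewrite size_map size_enum_ord. Qed.

Lemma nth_pword n (s : 'S_n) (i : 'I_n) : nth 0 (pword s) i = s i.
Proof. by rewrite (nth_map i) ?size_enum_ord ?nth_ord_enum. Qed.

Lemma pheightE n (s : 'S_n) h k : pheight s h k = (h%:Z + pheight s 0 k)%R.
Proof. by rewrite /pheight add0r. Qed.

Lemma pheight_lift n (j : 'I_n.+2) (s : 'S_n.+1) h k : k < n.+1 ->
  pheight (lift_perm ord0 j s) h k.+1 =
  (h%:Z + (if (j <= s ord0)%N then 1 else -1) + pheight s 0 k)%R.
Proof.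
move=> lt_kn; rewrite /pheight big_ord_recl pword_lift /=.
rewrite (nth_map 0) ?size_pword // (nth_pword s ord0).
have -> : (j < bump j (s ord0)) = (j <= s ord0) by rewrite /bump; lia.
under eq_bigr => i _.
  rewrite /bump /= add1n /= !(nth_map 0) ?size_pword; last 2 first.
  (* Both positions lie inside the word, so the default value of [nth] is never read. *)
  - by have := ltn_ord i; lia.
  - by have := ltn_ord i; lia.
  rewrite ltnNge leq_bump2 -ltnNge; over.
by rewrite add0r addrA.
Qed.

Lemma hb_ballot_lift n (j : 'I_n.+2) (s : 'S_n.+1) h b : cut s j ->
  hb_ballot h b (lift_perm ord0 j s) =
  if j == 0 :> nat then hb_ballot h.+1 b s
  else if h is h'.+1 then hb_ballot h' b s else false.
Proof.
(* If 0 < j <= s ord0, the letter 0 of [s] would come after its first letter, against the cut at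
   [j]. *)
move=> /cutP cP; have Ej : (j <= s ord0) = (j == 0 :> nat).
  case: (nat_of_ord j =P 0) => [-> //|/eqP j_neq0]; apply/negP => le_j.
  have := cP ord0 (s^-1%g ord0); rewrite permKV le_j /= (lt0n j) j_neq0.
  case: (posnP (s^-1%g ord0)) => [E _|_ /(_ isT) //].
  have {}E : s^-1%g ord0 = ord0 by apply: val_inj.
  by move: le_j; rewrite -E permKV /=; lia.
set t := lift_perm ord0 j s.
have allS : [forall k : 'I_n.+2, (0 <= pheight t h k)%R] =
            [forall k : 'I_n.+1, (0 <= pheight t h k.+1)%R].
  apply/forallP/forallP => tP k; first exact: (tP (lift ord0 k)).
  by case: (unliftP ord0 k) => [k' ->|-> /=]; rewrite ?tP // /pheight big_ord0.
rewrite /hb_ballot allS /= pheight_lift // Ej.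
under eq_forallb => k do rewrite pheight_lift // Ej.
case: eqP => _.
  have hS : (h.+1%:Z = h%:Z + 1)%R by lia.
  rewrite (pheightE s h.+1) hS; congr (_ && _).
  by apply: eq_forallb => k; rewrite [in RHS]pheightE hS.
(* From height 0, the initial descent reaches -1. *)
case: h @t allS => [|h] t allS.
  by apply/negP => /andP[/forallP/(_ ord0)]; rewrite /pheight big_ord0.
have -> : (h.+1%:Z - 1 = h%:Z)%R by lia.
rewrite (pheightE s h); congr (_ && _).
by apply: eq_forallb => k; rewrite [in RHS]pheightE.
Qed.

(** * The common recursion and the final counts *)

Lemma sum_bin_cuts b n h y :
  \sum_(s : 'S_n.+1 | avoids231 s && hb_ballot h b s) 'C((size (cuts s)).-2, y) =
  gb_walks b n h y.
Proof.
elim: n h y => [|n IH] h y.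
  have all1 (s : 'S_1) : s = 1%g.
    by apply/permP => i; rewrite !ord1.
  rewrite big_mkcond (big_pred1 1%g) => [|s]; last by rewrite (all1 s) /= eqxx.
  have -> : avoids231 (1%g : 'S_1).
    by apply/avoids231P => i j k; rewrite !ord1.
  have -> : hb_ballot h b (1%g : 'S_1) = (h == b).
    rewrite /hb_ballot /= /pheight big_ord0 addr0 eqz_nat.
    case: eqP; rewrite ?andbF ?andbT //= => _.
    by apply/forallP => k; rewrite ord1 big_ord0 addr0.
  rewrite /cuts /= cut0 cut_max /= bin0n.
  by case: (h == b).
(* With t + 2 cuts in [s], j = 0 contributes 'C(t.+1, y), and the t + 1 nonzero cuts add up to
   'C(t.+1, y.+1) by the hockey-stick sum. *)
have split_s (s : 'S_n.+1) :
    \sum_(j < n.+2 | cut s j) hb_ballot h b (lift_perm ord0 j s) *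
      'C((size (cuts (lift_perm ord0 j s))).-2, y) =
    hb_ballot h.+1 b s * 'C((size (cuts s)).-2.+1, y) +
    nat_of_bool (if h is h'.+1 then hb_ballot h' b s else false) *
      'C((size (cuts s)).-2.+1, y.+1).
  pose up := hb_ballot h.+1 b s.
  pose down := if h is h'.+1 then hb_ballot h' b s else false.
  transitivity (\sum_(j < n.+2 | cut s j) (if j == 0 :> nat then up else down) *
      'C((size [seq d <- cuts s | j <= d]).-1, y)).
    by apply: eq_bigr => j cj; rewrite hb_ballot_lift // cuts_lift /= size_map.
  rewrite (sum_cuts s (fun j => (if j == 0 :> nat then up else down) *
      'C((size [seq d <- cuts s | j <= d]).-1, y))).
  have [l [-> sl]] := cutsE s.
  have /allP gt0 : all (ltn 0) (rcons l n.+1).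
    by apply: order_path_min sl; apply: ltn_trans.
  rewrite big_cons /= filter_predT; congr (_ * 'C(_, _) + _).
    by rewrite size_rcons.
  rewrite size_rcons /= -[X in 'C(X, _)](size_rcons l n.+1).
  rewrite -sum_bin_sorted ?(path_sorted sl) // big_distrr /=.
  by apply: eq_big_seq => c /gt0 /=; case: c => [//|c _]; rewrite ltn0.
transitivity (\sum_(s : 'S_n.+1 | avoids231 s) \sum_(j < n.+2 | cut s j)
    hb_ballot h b (lift_perm ord0 j s) *
      'C((size (cuts (lift_perm ord0 j s))).-2, y)).
  rewrite big_mkcond big_lift_perm [RHS]big_mkcond /=.
  apply: eq_bigr => s _; rewrite [in RHS]big_mkcond /=.
  under eq_bigr => j _ do rewrite avoids231_lift.
  case: avoids231 => /=; last by rewrite big1.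
  by apply: eq_bigr => j _; case: cut; case: hb_ballot; rewrite ?mul1n.
under eq_bigr => s _ do rewrite split_s.
have sum_hb h' y' : \sum_(s : 'S_n.+1 | avoids231 s)
    hb_ballot h' b s * 'C((size (cuts s)).-2, y') = gb_walks b n h' y'.
  rewrite -IH big_mkcondr /=.
  by apply: eq_bigr => s _; case: hb_ballot; rewrite ?mul1n.
(* Pascal's rule splits the ascent term into the east and south steps, and the descent term into the
   north and west steps. *)
rewrite big_split /=; congr (_ + _).
  case: y {split_s} => [|y].
    by rewrite addn0 -sum_hb; apply: eq_bigr => s _; rewrite !bin0.
  rewrite -!sum_hb -big_split; apply: eq_bigr => s _.
  by rewrite binS mulnDr.
case: h {split_s} => [|h]; first by rewrite big1.
rewrite -!sum_hb -big_split; apply: eq_bigr => s _.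
by rewrite binS mulnDr addnC.
Qed.

Lemma card_hb_ballot231 n h b :
  #|[set s : 'S_n.+1 | hb_ballot h b s && avoids231 s]| = gb_walks b n h 0.
Proof.
rewrite -sum1dep_card -sum_bin_cuts.
by apply: eq_big => s; rewrite ?bin0 // andbC.
Qed.

(** The final height determines [b], so at most one summand is nonzero. *)
Lemma ballot_sum n (s : 'S_n) : ballot s = \sum_(b < n.+1) hb_ballot 0 b s :> nat.
Proof.
case: (boolP (ballot s)) => [/existsP[b sb]|/existsPn no_b]; last first.
  by rewrite big1 // => b _; rewrite (negPf (no_b b)).
rewrite (bigD1 b) //= sb big1 // => b' neq_b'; case: (boolP (hb_ballot 0 b' s)) => //.
case/andP: sb => _ /eqP Eb /andP[_ /eqP Eb'].
by case/eqP: neq_b'; apply: val_inj; apply/eqP; rewrite -eqz_nat -Eb -Eb'.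
Qed.

Lemma card_ballot231 n :
  #|[set s : 'S_n.+1 | ballot s && avoids231 s]| =
  \sum_(b < n.+2) gb_walks b n 0 0.
Proof.
under eq_bigr do rewrite -card_hb_ballot231 -sum1dep_card big_mkcond.
rewrite -sum1dep_card big_mkcond exchange_big; apply: eq_bigr => s _ /=.
case: (avoids231 s); last by rewrite andbF big1 // => b _; rewrite andbF.
rewrite andbT; under eq_bigr do rewrite andbT.
transitivity (nat_of_bool (ballot s)); first by case: ballot.
by rewrite ballot_sum; apply: eq_bigr => b _; case: hb_ballot.
Qed.

Theorem theorem4p6 :
  (forall n h b : nat,
     #|[set s : 'S_n.+1 | hb_ballot h b s && avoids231 s]| =
     #|[set w : n.-tuple 'I_4 | gb_walk h b w]|) /\
  (forall n : nat, 1 <= n ->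
     #|[set s : 'S_n | ballot s && avoids231 s]| =
     catalan n./2 * catalan n.+1./2).
Proof.
split=> [n h b|[//|n] _]; first by rewrite card_hb_ballot231 card_gb_walk.
by rewrite card_ballot231 sum_gb_walks.
Qed.
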